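(* Let $D$ be a weighted oriented path of length $n$ with underlying graph $G=P_n=x_0x_1\cdots x_n$ belonging to the class $T_1$. Then $$\operatorname{reg}(I(D))=\operatorname{reg}(I(G))+\sum_{x_i\in V^+\setminus\{x_j\}}(w(x_i)-1),$$ where $x_j$ is a vertex of $V^+$ of minimum weight.
   Context: A weighted oriented graph $D=(V(D),E(D),w)$ has directed edges $(x,y)$ and weights $w:V(D)\to\{1,2,\dots\}$; a source is assumed to have weight $1$. Its edge ideal is $I(D)=(x_ix_j^{w(x_j)}:(x_i,x_j)\in E(D))$ in the polynomial ring over a field whose variables are the vertices; $I(G)$ is the usual squarefree edge ideal of the simple underlying graph $G$. $V^+=\{x\in V(D): w(x)\ge 2\}$. A sink is a vertex all of whose incident edges are oriented into it. A path of length $n$ has $n$ edges. $T_1$ is the set of weighted oriented paths in which every vertex of $V^+$ is a sink, both end vertices lie in $V^+$, and the distance between any two consecutive vertices of $V^+$ along the path is $3$ (so $n$ is a multiple of $3$). $\operatorname{reg}$ is Castelnuovo–Mumford regularity. *)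

(* Defs.v *)
From HB Require Import structures.
From mathcomp Require Import all_boot all_order all_algebra.
From mathcomp.multinomials Require Import mpoly.
From Stdlib Require Import ClassicalEpsilon.
Set Implicit Arguments.
Unset Strict Implicit.
Unset Printing Implicit Defensive.
Import GRing.Theory Num.Theory.
Local Open Scope ring_scope.

Section Regularity.
Variables (n : nat) (K : fieldType).
Local Notation R := {mpoly K[n]}.

(* Sequences of graded free modules F_i = (+)_k R(- shift i k) with maps
     ... -> F_2 -> F_1 -> F_0 -> R,
   where R = K[x_1, ..., x_n]. Elements of F_i are row vectors, and maps act
   by right multiplication: row k of [gr_diff F i] is the image in F_i of the
   k-th basis vector of F_(i+1).
   Shifts in [nat] suffice, since a minimal resolution of an ideal of R only
   involves generators of nonnegative degree. *)
Record graded_free_seq := GradedFreeSeq {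
  gr_rank : nat -> nat;
  gr_shift : forall i, 'I_(gr_rank i) -> nat;
  gr_diff : forall i, 'M[R]_(gr_rank i.+1, gr_rank i);
  gr_aug : 'cV[R]_(gr_rank 0)
}.

Definition graded_maps (F : graded_free_seq) : Prop :=
  (forall k (m : 'X_{1..n}), m \in msupp (gr_aug F k ord0) ->
     mdeg m = gr_shift k) /\
  (forall i (k : 'I_(gr_rank F i.+1)) (l : 'I_(gr_rank F i)) (m : 'X_{1..n}),
     m \in msupp (gr_diff F i k l) -> (mdeg m + gr_shift l)%N = gr_shift k).

Definition resolves (I : R -> Prop) (F : graded_free_seq) : Prop :=
  [/\ forall p : R, I p <->
        exists u : 'rV[R]_(gr_rank F 0), p = (u *m gr_aug F) ord0 ord0,
      forall v : 'rV[R]_(gr_rank F 0),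
        v *m gr_aug F = 0 <-> exists u, v = u *m gr_diff F 0
    & forall i (v : 'rV[R]_(gr_rank F i.+1)),
        v *m gr_diff F i = 0 <-> exists u, v = u *m gr_diff F i.+1].

(* The image of each differential lies in (x_1, ..., x_n) F_i. *)
Definition minimal_maps (F : graded_free_seq) : Prop :=
  forall i k l, (gr_diff F i k l)@_(mnm0 (n:=n)) = 0.

Definition minimal_graded_free_resolution (I : R -> Prop)
    (F : graded_free_seq) : Prop :=
  [/\ graded_maps F, resolves I F & minimal_maps F].

(* The value is independent of the resolution F, because minimal graded free
   resolutions are unique up to isomorphism. *)
Definition betti (I : R -> Prop) (i j : nat) : nat :=
  epsilon (inhabits 0%N) (fun b : nat =>
    exists F : graded_free_seq, minimal_graded_free_resolution I F /\
      b = #|[set k : 'I_(gr_rank F i) | gr_shift k == j]|).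

Definition is_regularity (I : R -> Prop) (r : int) : Prop :=
  (exists i j : nat, betti I i j != 0%N /\ r = j%:Z - i%:Z) /\
  (forall i j : nat, betti I i j != 0%N -> j%:Z - i%:Z <= r).

(* reg I = max {j - i : betti I i j <> 0}; unspecified when this maximum does
   not exist, as for the zero ideal. *)
Definition reg (I : R -> Prop) : int := epsilon (inhabits 0) (is_regularity I).

End Regularity.

Record weighted_oriented_graph (V : finType) := WeightedOrientedGraph {
  arc : rel V;
  weight : V -> nat;
  arc_asym : forall x y, arc x y -> ~~ arc y x;
  weight_gt0 : forall x, (0 < weight x)%N;
  source_weight : forall x, (forall y, ~~ arc y x) -> weight x = 1%N
}.

Definition underlying (V : finType) (D : weighted_oriented_graph V) : rel V :=
  fun x y => arc D x y || arc D y x.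

Definition Vplus (V : finType) (D : weighted_oriented_graph V) : {set V} :=
  [set x | 2 <= weight D x]%N.

Definition sink (V : finType) (D : weighted_oriented_graph V) (x : V) : Prop :=
  forall y, underlying D x y -> arc D y x.

Section EdgeIdeals.
Variables (m : nat) (K : fieldType).

(* Ideal generated by the polynomials [g x y] over the pairs with [e x y]. *)
Definition ideal_of_pairs (e : rel 'I_m) (g : 'I_m -> 'I_m -> {mpoly K[m]}) :
    {mpoly K[m]} -> Prop :=
  fun p => exists c : 'I_m -> 'I_m -> {mpoly K[m]},
    p = \sum_(x < m) \sum_(y < m | e x y) c x y * g x y.

Definition edge_ideal (e : rel 'I_m) : {mpoly K[m]} -> Prop :=
  ideal_of_pairs e (fun x y => 'X_x * 'X_y).

Definition weighted_edge_ideal (D : weighted_oriented_graph 'I_m) :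
    {mpoly K[m]} -> Prop :=
  ideal_of_pairs (arc D) (fun x y => 'X_x * 'X_y ^+ weight D y).

End EdgeIdeals.

Arguments edge_ideal {m} K e _.
Arguments weighted_edge_ideal {m} K D _.

Definition path_edge (n : nat) : rel 'I_n.+1 :=
  fun x y => (x.+1 == y :> nat) || (y.+1 == x :> nat).

Definition weighted_oriented_path (n : nat)
    (D : weighted_oriented_graph 'I_n.+1) : Prop :=
  forall x y, underlying D x y = path_edge x y.

Definition class_T1 (n : nat) (D : weighted_oriented_graph 'I_n.+1) : Prop :=
  [/\ weighted_oriented_path D,
      forall x, x \in Vplus D -> sink D x,
      ord0 \in Vplus D,
      ord_max \in Vplus D
    & forall x y : 'I_n.+1, x \in Vplus D -> y \in Vplus D -> (x < y)%N ->
        (forall z : 'I_n.+1, (x < z < y)%N -> z \notin Vplus D) ->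
        (y - x)%N = 3%N].

(* Main.v *)
(* The vertices of V^+ are x_0, x_3, ..., x_n and they are sinks, so both ideals
   are generated by the products y_v y_(v+1) of consecutive powers y_v = x_v^(e_v),
   with e the weight for I(D) and e = 1 for I(G). Adding the last generator
   y_(m+1) y_(m+2) to the ideal P_(m+2) of a shorter path has colon ideal
   P_m + (y_m), and both extensions are resolved minimally by mapping cones. Hence
   the numbers q_m = 1 + reg (R / P_m) satisfy
     q_(m+3) = max (q_(m+2), q_m + e_m + e_(m+1) + e_(m+2) - 2),
   which, when e_v = 1 for all v not divisible by 3, gives
   q_(3k+1) = 1 + (sum of the e_(3i), i <= k) - (their minimum). Betti numbers do not
   depend on the minimal resolution, since a chain endomorphism lifting the identity
   is the identity modulo the variables. *)
Require Import Defs.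
From mathcomp Require Import all_boot all_order all_algebra.
From mathcomp.multinomials Require Import mpoly.
From Stdlib Require Import ClassicalEpsilon.
From mathcomp Require Import zify.
Set Implicit Arguments.
Unset Strict Implicit.
Unset Printing Implicit Defensive.
Import Order.TTheory GRing.Theory Num.Theory.
Local Open Scope ring_scope.

(** * Polynomials with prescribed monomials *)

Section Support.
Variables (n : nat) (K : fieldType).
Local Notation R := {mpoly K[n]}.
Implicit Types (p q : R) (P Q : 'X_{1..n} -> Prop) (U : pred 'X_{1..n}).

(** Homogeneity of a given degree and membership in a monomial ideal both take this form; with [P]
    valued in [Prop], zero belongs to every such set. *)
Definition supp_in P p : Prop := forall m, m \in msupp p -> P m.

Lemma supp_in_imp P Q p : (forall m, P m -> Q m) -> supp_in P p -> supp_in Q p.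
Proof. by move=> PQ Pp m /Pp /PQ. Qed.

Lemma supp_in0 P : supp_in P 0.
Proof. by move=> m; rewrite msupp0. Qed.

Lemma supp_inD P p q : supp_in P p -> supp_in P q -> supp_in P (p + q).
Proof. by move=> Pp Pq m /msuppD_le; rewrite mem_cat => /orP[/Pp|/Pq]. Qed.

Lemma supp_inN P p : supp_in P p -> supp_in P (- p).
Proof. by move=> Pp m; rewrite (perm_mem (msuppN p)) => /Pp. Qed.

Lemma supp_inB P p q : supp_in P p -> supp_in P q -> supp_in P (p - q).
Proof. by move=> Pp Pq; apply: supp_inD => //; apply: supp_inN. Qed.

Lemma supp_in_sum (I : Type) (r : seq I) (C : pred I) (F : I -> R) P :
  (forall i, C i -> supp_in P (F i)) -> supp_in P (\sum_(i <- r | C i) F i).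
Proof.
by move=> PF; elim/big_ind: _ => //; [exact: supp_in0 | move=> *; exact: supp_inD].
Qed.

Lemma supp_inM P Q T p q :
    (forall m1 m2, P m1 -> Q m2 -> T (m1 + m2)%MM) ->
  supp_in P p -> supp_in Q q -> supp_in T (p * q).
Proof.
move=> PQT Pp Qq m /msuppM_le /allpairsP[[m1 m2] /= [m1p m2q ->]].
by apply: PQT; [apply: Pp | apply: Qq].
Qed.

Lemma supp_inX P m : supp_in P 'X_[m] <-> P m.
Proof.
split=> [|Pm m']; first by apply; rewrite msuppX inE.
by rewrite msuppX inE => /eqP ->.
Qed.

Lemma supp_inMX P p u :
  supp_in P (p * 'X_[u]) <-> supp_in (fun m => P (u + m)%MM) p.
Proof.
split=> [Pp m mp | Pp m].
  by apply: Pp; rewrite (perm_mem (msuppMX p u)) map_f.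
by rewrite (perm_mem (msuppMX p u)) => /mapP[m' /Pp Pm ->].
Qed.

Lemma supp_in_disjoint P Q p :
  (forall m, P m -> ~ Q m) -> supp_in P p -> supp_in Q p -> p = 0.
Proof.
move=> PQ Pp Qp; apply/eqP; rewrite -msupp_eq0.
case E: (msupp p) => [|m s] //.
have mp : m \in msupp p by rewrite E inE eqxx.
by case: (PQ m (Pp _ mp) (Qp _ mp)).
Qed.

Definition mpart U p : R := \sum_(m <- msupp p | U m) p@_m *: 'X_[m].

Lemma mcoeff_mpart U p m : (mpart U p)@_m = if U m then p@_m else 0.
Proof.
rewrite /mpart raddf_sum /= big_mkcond /=.
case: (boolP (m \in msupp p)) => [mp | /memN_msupp_eq0 p0].
  rewrite (bigD1_seq m) //= big1_seq => [|m' /andP[m'm _]].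
    by rewrite addr0 mcoeffZ mcoeffX eqxx mulr1.
  by rewrite mcoeffZ mcoeffX (negPf m'm) mulr0 if_same.
rewrite p0 if_same big1_seq // => m' /= m'p.
rewrite mcoeffZ mcoeffX; case: eqP => [E | _]; last by rewrite mulr0 if_same.
by rewrite E p0 mul0r if_same.
Qed.

Lemma supp_in_mpart U p : supp_in U (mpart U p).
Proof.
by move=> m; rewrite mcoeff_msupp mcoeff_mpart; case: (U m); rewrite ?eqxx.
Qed.

Lemma supp_in_mpartN U p : supp_in (fun m => ~~ U m) (p - mpart U p).
Proof.
move=> m; rewrite mcoeff_msupp mcoeffB mcoeff_mpart.
by case: (U m); rewrite // subrr eqxx.
Qed.

Lemma supp_in_mpart_sub P U p : supp_in P p -> supp_in P (p - mpart U p).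
Proof.
move=> Pp m; rewrite mcoeff_msupp mcoeffB mcoeff_mpart.
by case: (U m) => [|]; rewrite ?subrr ?eqxx // subr0 -mcoeff_msupp => /Pp.
Qed.

Lemma supp_in_multiple u p :
  supp_in (fun m => (u <= m)%MM) p -> exists c, p = c * 'X_[u].
Proof.
move=> up; exists (\sum_(m <- msupp p) p@_m *: 'X_[m - u]).
rewrite mulr_suml {1}[p]mpolyE; apply: eq_big_seq => m /up um.
by rewrite -scalerAl -mpolyXD submK.
Qed.

End Support.

(** * Graded maps between free modules *)

Section HomogeneousMatrices.
Variables (n : nat) (K : fieldType).
Local Notation R := {mpoly K[n]}.

(** These are the degree-0 maps from the sum of the R(- s k) to the sum of the R(- t l). The degree
    condition is additive to avoid truncated subtraction, and zero entries are allowed. *)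
Definition homog_mx a b (s : 'I_a -> nat) (t : 'I_b -> nat) (A : 'M[R]_(a, b)) :=
  forall k l, supp_in (fun m => mdeg m + t l = s k)%N (A k l).

Lemma homog_mxM a b c (s : 'I_a -> nat) (t : 'I_b -> nat) (u : 'I_c -> nat)
    (A : 'M[R]_(a, b)) (B : 'M[R]_(b, c)) :
  homog_mx s t A -> homog_mx t u B -> homog_mx s u (A *m B).
Proof.
move=> hA hB k l; rewrite mxE; apply: supp_in_sum => i _.
apply: supp_inM (hA k i) (hB i l) => m1 m2 <- <-.
by rewrite mdegD addnA.
Qed.

Lemma homog_mx_addn d a b (s : 'I_a -> nat) (t : 'I_b -> nat) (A : 'M[R]_(a, b)) :
  homog_mx s t A -> homog_mx (fun k => s k + d)%N (fun l => t l + d)%N A.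
Proof. by move=> hA k l; apply: supp_in_imp (hA k l) => m <-; rewrite addnA. Qed.

Lemma homog_mxZ d a b (s : 'I_a -> nat) (t : 'I_b -> nat) (A : 'M[R]_(a, b)) (p : R) :
    supp_in (fun m => mdeg m = d) p -> homog_mx s t A ->
  homog_mx (fun k => s k + d)%N t (p *: A).
Proof.
move=> hp hA k l; rewrite mxE; apply: supp_inM hp (hA k l) => m1 m2 <- <-.
by rewrite mdegD -addnA addnC.
Qed.

(* A solution of [V = W *m A] stays one after keeping only the monomials of [W]
   of the right degree. *)
Lemma homog_solution a b c (s : 'I_a -> nat) (t : 'I_b -> nat) (u : 'I_c -> nat)
    (V : 'M[R]_(a, c)) (A : 'M[R]_(b, c)) :
    homog_mx s u V -> homog_mx t u A -> (exists W, V = W *m A) ->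
  exists2 W, homog_mx s t W & V = W *m A.
Proof.
move=> hV hA [W VE].
pose U k l (m : 'X_{1..n}) := (mdeg m + t l == s k)%N.
pose W' := \matrix_(k < a, l < b) mpart (U k l) (W k l).
have hW' : homog_mx s t W'.
  by move=> k l; rewrite mxE => m /supp_in_mpart /eqP.
exists W' => //; apply/eqP; rewrite -subr_eq0; apply/eqP/matrixP=> k l.
rewrite [RHS]mxE.
have homogE : homog_mx s u (W' *m A) by apply: homog_mxM hA.
(* An entry of [V - W' *m A] has only monomials of the right degree, since both terms are
   homogeneous. It is also an entry of [(W - W') *m A], where only wrong degrees survive, so it
   vanishes. *)
apply: (@supp_in_disjoint _ _ (fun m => mdeg m + u l = s k)%N
                        (fun m => mdeg m + u l <> s k)%N); first by move=> m ? /(_ _).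
  by rewrite !mxE; apply: supp_inB; [exact: hV | have := homogE k l; rewrite mxE].
rewrite VE -mulmxBl mxE; apply: supp_in_sum => i _.
rewrite !mxE; apply: (supp_inM _ (@supp_in_mpartN _ _ (U k i) (W k i)) (hA i l)).
by move=> m1 m2 /eqP m1N m2E; rewrite mdegD -addnA m2E.
Qed.

End HomogeneousMatrices.

(** * Exactness and comparison of graded free resolutions *)

Section Exactness.
Variable R : comNzRingType.

Definition exact_mx a b c (E : 'M[R]_(a, b)) (D : 'M[R]_(b, c)) : Prop :=
  forall v : 'rV_b, v *m D = 0 <-> exists u, v = u *m E.

Lemma mx_solution a b c (V : 'M[R]_(a, c)) (A : 'M[R]_(b, c)) :
  (forall k, exists u : 'rV_b, row k V = u *m A) -> exists W, V = W *m A.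
Proof.
move=> /fin_all_exists[f fE]; exists (\matrix_k f k).
by apply/row_matrixP=> k; rewrite row_mul rowK.
Qed.

Lemma exact_mx_ker a b c d (E : 'M[R]_(a, b)) (D : 'M[R]_(b, c)) (V : 'M[R]_(d, b)) :
  exact_mx E D -> V *m D = 0 -> exists W, V = W *m E.
Proof.
move=> ED VD; apply: mx_solution => k; apply/ED.
by rewrite -row_mul VD row0.
Qed.

Lemma exact_mx0 a b c (E : 'M[R]_(a, b)) (D : 'M[R]_(b, c)) :
  exact_mx E D -> E *m D = 0.
Proof.
move=> ED; apply/row_matrixP=> k; rewrite row_mul row0.
by apply/ED; exists (delta_mx 0 k); rewrite rowE.
Qed.

End Exactness.

(** Dependent choice in a family of types: the matrices of a chain map change size with the
    homological degree. *)
Lemma dependent_sequence (T : nat -> Type) (P : forall i, T i -> Prop)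
    (Q : forall i, T i -> T i.+1 -> Prop) :
    (exists x, P 0 x) ->
    (forall i x, P i x -> exists2 y, P i.+1 y & Q i x y) ->
  exists f : forall i, T i, P 0 (f 0) /\ forall i, P i (f i) /\ Q i (f i) (f i.+1).
Proof.
move=> /constructive_indefinite_description[x0 Px0] step.
have next i (x : {x : T i | P i x}) : {y : T i.+1 | P i.+1 y /\ Q i (sval x) y}.
  apply: constructive_indefinite_description.
  by case: (step i (sval x) (svalP x)) => y; exists y.
pose f := fix f i : {x : T i | P i x} :=
  if i is j.+1 return {x : T i | P i x}
  then let y := next j (f j) in exist _ (sval y) (proj1 (svalP y))
  else exist _ x0 Px0.
exists (fun i => sval (f i)); split=> // i; split; first exact: (svalP (f i)).
exact: (proj2 (svalP (next i (f i)))).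
Qed.

Section ChainMaps.
Variables (n : nat) (K : fieldType).
Local Notation R := {mpoly K[n]}.
Local Notation shift F i := (@gr_shift n K F i).
Implicit Types (F G : graded_free_seq n K) (I J : R -> Prop).

Lemma resolves_aug0 I F : resolves I F -> gr_diff F 0 *m gr_aug F = 0.
Proof. by case=> _ F0 _; apply: exact_mx0 F0. Qed.

Lemma resolves_diff0 I F i : resolves I F -> gr_diff F i.+1 *m gr_diff F i = 0.
Proof. by case=> _ _ Fi; apply: exact_mx0 (Fi i). Qed.

Lemma graded_aug F : graded_maps F -> homog_mx (shift F 0) (fun _ => 0%N) (gr_aug F).
Proof. by move=> [hF _] k l m; rewrite ord1 addn0 => /hF. Qed.

Lemma graded_diff F i : graded_maps F ->
  homog_mx (@gr_shift _ _ F i.+1) (shift F i) (gr_diff F i).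
Proof. by move=> [_ hF] k l m /hF. Qed.

Lemma gr_aug_in_ideal I F k : resolves I F -> I (gr_aug F k ord0).
Proof. by case=> IF _ _; apply/IF; exists (delta_mx 0 k); rewrite -rowE mxE. Qed.

Lemma aug_solution I F a (V : 'cV[R]_a) :
  resolves I F -> (forall k, I (V k ord0)) -> exists W, V = W *m gr_aug F.
Proof.
move=> [IF _ _] IV; apply: mx_solution => k; have [u uE] := (IF _).1 (IV k).
by exists u; apply/matrixP=> i j; rewrite !ord1 mxE uE.
Qed.

(** The chain maps from F(-d) to G over multiplication by [b]. *)
Record chain_lift (b : R) (d : nat) F G
    (psi : forall i, 'M[R]_(gr_rank F i, gr_rank G i)) : Prop := ChainLift {
  lift_homog : forall i,
    homog_mx (fun k => shift F i k + d)%N (shift G i) (psi i);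
  lift_aug : psi 0 *m gr_aug G = b *: gr_aug F;
  lift_diff : forall i, gr_diff F i *m psi i = psi i.+1 *m gr_diff G i
}.

(** The comparison theorem: each component is lifted through the exactness of [G], and
    [homog_solution] makes the lift homogeneous. *)
Lemma chain_lift_exists (b : R) d I J F G :
    graded_maps F -> resolves I F -> graded_maps G -> resolves J G ->
    supp_in (fun m => mdeg m = d) b -> (forall p, I p -> J (b * p)) ->
  exists psi, @chain_lift b d F G psi.
Proof.
move=> grF resF grG resG hb bIJ.
pose hom i : 'M[R]_(gr_rank F i, gr_rank G i) -> Prop :=
  homog_mx (fun k => shift F i k + d)%N (shift G i).
(* The invariant may mention only the current component [X]. It records just what the next lift
   needs: that [gr_diff F i *m X] is killed by the following map of [G]. *)
pose P i : 'M[R]_(gr_rank F i, gr_rank G i) -> Prop :=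
  match i with
  | 0 => fun X => hom 0 X /\ X *m gr_aug G = b *: gr_aug F
  | i.+1 => fun X => hom i.+1 X /\ gr_diff F i.+1 *m (X *m gr_diff G i) = 0
  end.
have stepK i X : P i X -> hom i X /\ exists2 Y, hom i.+1 Y &
    gr_diff F i *m X = Y *m gr_diff G i.
  move=> PX; have homX : hom i X by case: i X PX => [|i] X [].
  split=> //; rewrite /hom.
  apply: (homog_solution _ (graded_diff grG)).
    exact: homog_mxM (homog_mx_addn d (graded_diff grF)) homX.
  case: resG => _ G0 Gi; case: i X PX {homX} => [|i] X [_ XE].
    by apply: exact_mx_ker G0 _; rewrite -mulmxA XE -scalemxAr (resolves_aug0 resF) scaler0.
  by apply: exact_mx_ker (Gi i) _; rewrite -mulmxA XE.
pose Q i (X : 'M[R]_(gr_rank F i, gr_rank G i)) Y :=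
  gr_diff F i *m X = Y *m gr_diff G i.
have [||psi [psi0 psiE]] := @dependent_sequence _ P Q.
- case: (@homog_solution _ _ _ _ _ (fun k => shift F 0 k + d)%N
    (shift G 0) (fun _ => 0%N) (b *: gr_aug F) _ _ (graded_aug grG)).
  + exact: homog_mxZ hb (graded_aug grF).
  + by apply: (aug_solution resG) => k; rewrite mxE; apply: bIJ; apply: gr_aug_in_ideal.
  by move=> X homX XE; exists X; split.
- move=> i X /stepK[homX [Y homY XY]]; exists Y => //; split=> //.
  by rewrite -XY mulmxA (resolves_diff0 _ resF) mul0mx.
exists psi; split=> [i||i]; [|by case: psi0|by case: (psiE i)].
by case: (psiE i) => /stepK[].
Qed.

(** Reduction modulo the variables, that is, the matrix tensored with the residue field [K]. *)
Definition const_mx_part a b (A : 'M[R]_(a, b)) : 'M[K]_(a, b) :=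
  map_mx (mcoeff (mnm0 (n:=n))) A.

Lemma minimal_const F i : minimal_maps F -> const_mx_part (gr_diff F i) = 0.
Proof. by move=> mF; apply/matrixP=> k l; rewrite !mxE mF. Qed.

(* A chain endomorphism over the zero map is null-homotopic, and the
   differentials have no constant terms. *)
Lemma null_chain_const I F (gamma : forall i, 'M[R]_(gr_rank F i)) :
    resolves I F -> minimal_maps F -> gamma 0 *m gr_aug F = 0 ->
    (forall i, gr_diff F i *m gamma i = gamma i.+1 *m gr_diff F i) ->
  forall i, const_mx_part (gamma i) = 0.
Proof.
move=> resF minF gamma0 gammaE i.
have constM a b c (A : 'M[R]_(a, b)) (B : 'M[R]_(b, c)) :
    const_mx_part (A *m B) = const_mx_part A *m const_mx_part B.
  exact: map_mxM.
(* [h] is the homotopy in degree [i], and [E] is the contribution of the homotopy from the degree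
   below, zero at the start. Only two properties of [E] are kept: the differential kills it, and it
   has no constant terms. *)
suff [h [E [-> _ constE]]] : exists h E,
    [/\ gamma i = h *m gr_diff F i + E, gr_diff F i *m E = 0 & const_mx_part E = 0].
  by rewrite /const_mx_part map_mxD -!/(const_mx_part _) constM minimal_const // mulmx0 add0r.
have [_ F0 Fi] := resF; elim: i => [|i [h [E [gE dE constE]]]].
  have [h hE] := exact_mx_ker F0 gamma0; exists h, 0.
  by rewrite addr0 mulmx0 /const_mx_part map_mx0.
have [h' h'E] : exists h', gamma i.+1 - gr_diff F i *m h = h' *m gr_diff F i.+1.
  apply: exact_mx_ker (Fi i) _.
  by rewrite mulmxBl -gammaE gE mulmxDr dE addr0 mulmxA subrr.
exists h', (gr_diff F i *m h); split; first by rewrite -h'E subrK.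
  by rewrite mulmxA (resolves_diff0 _ resF) mul0mx.
by rewrite constM minimal_const // mul0mx.
Qed.

End ChainMaps.

(** * Invariance of Betti numbers, and regularity *)

(** In the entries of [A *m B] with row in [S], columns of [A] outside [T] contribute nothing. Hence
    the [S] by [T] block of [A] has a right inverse, so its rank is the size of [S]. *)
Lemma card_block_le (K : fieldType) a b (A : 'M[K]_(a, b)) (B : 'M[K]_(b, a))
    (S : {set 'I_a}) (T : {set 'I_b}) :
    A *m B = 1%:M -> (forall k l, k \in S -> l \notin T -> A k l = 0) ->
  (#|S| <= #|T|)%N.
Proof.
move=> AB AST.
pose A' := \matrix_(k < #|S|, l < #|T|) A (enum_val k) (enum_val l).
pose B' := \matrix_(l < #|T|, k < #|S|) B (enum_val l) (enum_val k).
have A'B' : A' *m B' = 1%:M.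
  apply/matrixP=> k k'; rewrite mxE.
  have := congr1 (fun M : 'M_a => M (enum_val k) (enum_val k')) AB.
  rewrite !mxE (inj_eq enum_val_inj) => <-.
  rewrite (bigID (mem T)) /= [X in _ + X]big1 ?addr0 => [|l lT]; last first.
    by rewrite AST ?mul0r ?enum_valP.
  by rewrite [RHS]big_enum_val; apply: eq_bigr => l _; rewrite !mxE.
by rewrite -[leqLHS](mxrank1 K) -A'B' (leq_trans (mxrankM_maxl _ _)) ?rank_leq_col.
Qed.

Section BettiNumbers.
Variables (n : nat) (K : fieldType).
Local Notation R := {mpoly K[n]}.
Implicit Types (F G : graded_free_seq n K) (I J : R -> Prop).

Definition gr_block F i j : {set 'I_(gr_rank F i)} := [set k | gr_shift k == j].

(** Comparison maps in both directions compose to a lift of the identity, so their constant parts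
    compose to the identity matrix. By homogeneity a nonzero constant term occurs only between
    generators of equal shift, so [card_block_le] applies to each shift separately. *)
Lemma gr_block_card_le I F G i j :
    minimal_graded_free_resolution I F -> minimal_graded_free_resolution I G ->
  (#|gr_block F i j| <= #|gr_block G i j|)%N.
Proof.
move=> [grF resF minF] [grG resG minG].
have hom1 : supp_in (fun m => mdeg m = 0%N) (1 : R).
  by move=> m; rewrite msupp1 inE => /eqP ->; rewrite mdeg0.
have id1 p : I p -> I (1 * p) by rewrite mul1r.
have [f [homf augf diff]] := chain_lift_exists grF resF grG resG hom1 id1.
have [g [homg augg difg]] := chain_lift_exists grG resG grF resF hom1 id1.
have fg1 : const_mx_part (f i) *m const_mx_part (g i) = 1%:M.
  rewrite -map_mxM; apply/eqP; rewrite -subr_eq0; apply/eqP.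
  rewrite -(map_mx1 (mcoeff (mnm0 (n:=n)))) -map_mxB.
  apply: (null_chain_const (gamma := fun i => f i *m g i - 1%:M) resF minF).
    by rewrite mulmxBl -mulmxA augg scale1r augf scale1r mul1mx subrr.
  move=> k; rewrite mulmxBl mulmxBr mulmx1 mul1mx; congr (_ - _).
  by rewrite mulmxA diff -!mulmxA difg.
apply: card_block_le fg1 _ => k l; rewrite !inE mxE => /eqP <- ls.
apply/eqP; rewrite mcoeff_eq0; apply: contra ls => /homf.
by rewrite mdeg0 add0n addn0 => ->.
Qed.

Lemma bettiE I F i j :
  minimal_graded_free_resolution I F -> betti I i j = #|gr_block F i j|.
Proof.
move=> mF; rewrite /betti.
case: (epsilon_spec (inhabits 0%N) (fun b => exists G,
  minimal_graded_free_resolution I G /\ b = #|gr_block G i j|)) => [|G [mG ->]].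
  by exists #|gr_block F i j|, F.
by apply/eqP; rewrite eqn_leq !(gr_block_card_le (I := I)).
Qed.

Lemma betti_neq0 I F i j : minimal_graded_free_resolution I F ->
  betti I i j != 0%N <-> exists k : 'I_(gr_rank F i), gr_shift k = j.
Proof.
move=> mF; rewrite (bettiE _ _ mF) -lt0n; split.
  by case/card_gt0P=> k; rewrite inE => /eqP; exists k.
by move=> [k kj]; apply/card_gt0P; exists k; rewrite inE kj.
Qed.

(* [q] is [1 + reg (R / I)]: the free module [R] in homological degree [-1]
   counts for [1], so that the zero ideal has a value too. *)
Definition regularity_at I (q : nat) : Prop :=
  (1 <= q)%N /\ exists F, [/\ minimal_graded_free_resolution I F,
    forall i (k : 'I_(gr_rank F i)), (gr_shift k <= q + i)%N
  & q = 1%N \/ exists i (k : 'I_(gr_rank F i)), gr_shift k = (q + i)%N].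

(** For [q] above 1 the bound is attained by a generator of the resolution, so [q] is a maximum;
    maxima are unique, so [epsilon] can only return this value. *)
Lemma reg_eq I q : regularity_at I q -> (1 < q)%N -> reg I = q%:Z.
Proof.
move=> [_ [F [mF leF attF]]] q1.
have [q_eq1 | [i [k kE]]] := attF; first by rewrite q_eq1 in q1.
have regq : is_regularity I q%:Z.
  split=> [|a b /(betti_neq0 _ _ mF)[l <-]]; last by have := leF _ l; lia.
  exists i, (q + i)%N; split; last by lia.
  by apply/(betti_neq0 _ _ mF); exists k.
have := epsilon_spec (inhabits 0) (is_regularity I) (ex_intro _ _ regq).
rewrite -/(reg I) => -[[a [b [ab regE]]] le_r].
case: regq => [[a' [b' [ab' qE]]] le_q].
by apply/eqP; rewrite eq_le {1}regE le_q //= qE le_r.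
Qed.

End BettiNumbers.

(** * Mapping cones and their regularity *)

Section MappingCone.
Variables (n : nat) (K : fieldType).
Local Notation R := {mpoly K[n]}.
Local Notation shift F i := (@gr_shift n K F i).
Implicit Types (F G : graded_free_seq n K) (I J : R -> Prop).

Definition join_shift a b (s : 'I_a -> nat) (t : 'I_b -> nat) (k : 'I_(a + b)) : nat :=
  match split k with inl i => s i | inr j => t j end.

Lemma join_shiftl a b (s : 'I_a -> nat) (t : 'I_b -> nat) k :
  join_shift s t (lshift b k) = s k.
Proof. by rewrite /join_shift -[lshift b k]/(unsplit (inl k)) unsplitK. Qed.

Lemma join_shiftr a b (s : 'I_a -> nat) (t : 'I_b -> nat) k :
  join_shift s t (rshift a k) = t k.
Proof. by rewrite /join_shift -[rshift a k]/(unsplit (inr k)) unsplitK. Qed.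

Lemma homog_block_mx a b c d (s : 'I_a -> nat) (t : 'I_b -> nat) (u : 'I_c -> nat)
    (v : 'I_d -> nat) (A : 'M[R]_(a, c)) (B : 'M[R]_(a, d)) (D : 'M[R]_(b, d)) :
  homog_mx s u A -> homog_mx s v B -> homog_mx t v D ->
  homog_mx (join_shift s t) (join_shift u v) (block_mx A B 0 D).
Proof.
move=> hA hB hD k l.
case: (split_ordP k) => i ->; case: (split_ordP l) => j ->;
  rewrite ?block_mxEul ?block_mxEur ?block_mxEdl ?block_mxEdr
    ?join_shiftl ?join_shiftr //.
by rewrite mxE; apply: supp_in0.
Qed.

(** Diagram chase: for (x, y) in the kernel, x = u A' by exactness of the first row. Commutativity
    then puts u P' + y in the kernel of [B], so it equals w B', and (-u, w) is a preimage. *)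
Lemma exact_block_mx a2 a1 a0 b3 b2 b1
    (A' : 'M[R]_(a2, a1)) (A : 'M[R]_(a1, a0)) (B' : 'M[R]_(b3, b2)) (B : 'M[R]_(b2, b1))
    (P' : 'M[R]_(a2, b2)) (P : 'M[R]_(a1, b1)) :
    exact_mx A' A -> exact_mx B' B -> A' *m P = P' *m B ->
  exact_mx (block_mx (- A') P' 0 B') (block_mx (- A) P 0 B).
Proof.
move=> exA exB AP v; split=> [|[u ->]]; last first.
  rewrite -mulmxA mulmx_block !mulNmx !mulmxN (exact_mx0 exA) (exact_mx0 exB) AP.
  by rewrite !mulmx0 !mul0mx !oppr0 !addr0 addNr block_mx0 mulmx0.
rewrite -[v]hsubmxK; move: (lsubmx v) (rsubmx v) => x y.
rewrite mul_row_block !mulmx0 addr0 mulmxN -row_mx0 => /eq_row_mx[/eqP].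
rewrite oppr_eq0 => /eqP /exA[u ->] uyP.
have /exB[w wE] : (u *m P' + y) *m B = 0.
  by rewrite mulmxDl -mulmxA -AP mulmxA.
exists (row_mx (- u) w); rewrite mul_row_block mulmx0 addr0 mulNmx mulmxN opprK.
by rewrite mulNmx -wE addKr.
Qed.

(** The cone is taken over [F] augmented by R in homological degree -1. That copy of R is the extra
    1 in degree 0, and its basis vector maps to the new generator. *)
Definition cone_rank F G (i : nat) : nat :=
  if i is j.+1 then gr_rank F j + gr_rank G j.+1 else 1 + gr_rank G 0.

Definition cone_shift d F G i : 'I_(cone_rank F G i) -> nat :=
  match i return 'I_(cone_rank F G i) -> nat with
  | 0 => join_shift (fun _ : 'I_1 => d) (shift G 0)
  | j.+1 => join_shift (fun k => shift F j k + d)%N (shift G j.+1)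
  end.

Definition cone_diff F G (phi : forall i, 'M[R]_(gr_rank F i, gr_rank G i)) i :
    'M[R]_(cone_rank F G i.+1, cone_rank F G i) :=
  match i return 'M[R]_(cone_rank F G i.+1, cone_rank F G i) with
  | 0 => block_mx (- gr_aug F) (phi 0) 0 (gr_diff G 0)
  | j.+1 => block_mx (- gr_diff F j) (phi j.+1) 0 (gr_diff G j.+1)
  end.

Definition mapping_cone (g : R) d F G phi : graded_free_seq n K :=
  @GradedFreeSeq n K (cone_rank F G) (@cone_shift d F G) (cone_diff phi)
    (col_mx g%:M (gr_aug G)).

Variables (I J : R -> Prop) (F G : graded_free_seq n K) (g : R) (d : nat).
Variable phi : forall i, 'M[R]_(gr_rank F i, gr_rank G i).
Hypothesis phi_lift : chain_lift g d phi.
Let C := mapping_cone g d phi.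

Lemma mapping_cone_graded :
    graded_maps F -> graded_maps G -> supp_in (fun m => mdeg m = d) g ->
  graded_maps C.
Proof.
move=> grF grG hg; split=> [k m | i k l m].
  rewrite /= /cone_shift; case: (split_ordP k) => j ->.
    by rewrite col_mxEu join_shiftl ord1 mxE eqxx mulr1n => /hg.
  by rewrite col_mxEd join_shiftr; apply: grG.1.
have homN a b s t (A : 'M[R]_(a, b)) : homog_mx s t A -> homog_mx s t (- A).
  by move=> hA k' l'; rewrite mxE; apply: supp_inN.
have homC : homog_mx (@cone_shift d F G i.+1) (@cone_shift d F G i) (cone_diff phi i).
  case: i {k l} => [|i] /=; apply: homog_block_mx;
    try exact: (lift_homog phi_lift); try exact: graded_diff.
    apply: homN => k l; have := @graded_aug _ _ F grF k l.
    by apply: supp_in_imp => {}m <-; lia.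
  by apply: homN; apply: homog_mx_addn; apply: graded_diff.
exact: homC.
Qed.

(** This reflects the exact sequence 0 -> R/I(-d) -> R/J -> R/H -> 0, in which [I] is the colon
    ideal of [J] by [g] and [H] is [J] + ([g]). *)
Lemma mapping_cone_resolves H :
    resolves I F -> resolves J G -> (forall p, I p <-> J (p * g)) ->
    (forall p, H p <-> exists c q, J q /\ p = c * g + q) ->
  resolves H C.
Proof.
move=> resF resG colon HE.
have [IF F0 Fi] := resF; have [JG G0 Gi] := resG.
have [_ phi_aug phi_diff] := phi_lift.
split.
- move=> p; rewrite HE; split=> [[c [q [/JG[u qE] ->]]] | [u ->]].
    exists (row_mx c%:M u).
    by rewrite mul_row_col -scalar_mxM qE [RHS]mxE [X in _ = X + _]mxE eqxx mulr1n.
  exists (lsubmx u ord0 ord0), ((rsubmx u *m gr_aug G) ord0 ord0); split.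
    by apply/JG; exists (rsubmx u).
  rewrite -{1}[u]hsubmxK mul_row_col mxE; congr (_ + _).
  by rewrite mul_mx_scalar mxE mulrC.
- move=> v; split=> [|[u ->]]; last first.
    rewrite -mulmxA mul_block_col mulNmx phi_aug mul_mx_scalar addNr.
    by rewrite (resolves_aug0 resG) mul0mx addr0 col_mx0 mulmx0.
  rewrite -[v]hsubmxK; move: (lsubmx v) (rsubmx v) => c y.
  rewrite mul_row_col mul_mx_scalar => cy0.
  (* In a relation between [g] and the generators of [J], the coefficient of [g] multiplies [g] into
     [J], hence lies in the colon ideal [I]. *)
  have /colon/IF[u uE] : J (c ord0 ord0 * g).
    apply/JG; exists (- y); move/matrixP/(_ ord0 ord0)/eqP: cy0.
    rewrite mulNmx [X in X == _]mxE [X in X + _]mxE [X in _ == X]mxE [RHS]mxE.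
    by rewrite mulrC addr_eq0 => /eqP.
  have cE : c = u *m gr_aug F by apply/matrixP=> k l; rewrite !ord1.
  have /G0[w wE] : (u *m phi 0 + y) *m gr_aug G = 0.
    by rewrite mulmxDl -mulmxA phi_aug -scalemxAr -cE.
  exists (row_mx (- u) w); rewrite mul_row_block mulmx0 addr0 mulNmx mulmxN opprK.
  by rewrite cE mulNmx -wE addKr.
- by case=> [|i]; apply: exact_block_mx.
Qed.

Lemma mapping_cone_minimal :
    resolves I F -> minimal_maps F -> minimal_maps G ->
    (forall p, I p -> p@_(mnm0 (n:=n)) = 0) ->
    (forall i, const_mx_part (phi i) = 0) ->
  minimal_maps C.
Proof.
move=> resF minF minG I0 phi0 i.
have entry0 a b (A : 'M[R]_(a, b)) k l : const_mx_part A = 0 -> (A k l)@_(mnm0 (n:=n)) = 0.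
  by move=> /matrixP/(_ k l); rewrite !mxE.
suff cone0 : const_mx_part (cone_diff phi i) = 0 by move=> k l; apply: entry0.
have constN a b (A : 'M[R]_(a, b)) : const_mx_part A = 0 -> const_mx_part (- A) = 0.
  by rewrite /const_mx_part map_mxN => ->; rewrite oppr0.
case: i => [|i]; rewrite /const_mx_part [cone_diff _ _]/= map_block_mx.
  rewrite -!/(const_mx_part _) phi0 !minimal_const // constN; last first.
    by apply/matrixP=> k l; rewrite !mxE ord1; apply: I0; apply: gr_aug_in_ideal.
  by rewrite /const_mx_part map_mx0 block_mx0.
rewrite -!/(const_mx_part _) phi0 !minimal_const // constN ?minimal_const //.
by rewrite /const_mx_part map_mx0 block_mx0.
Qed.

End MappingCone.

Section ConeRegularity.
Variables (n : nat) (K : fieldType).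
Local Notation R := {mpoly K[n]}.

(* The mapping cone is minimal because the chain map over [a * b] is chosen to be
   [a] times a lift of [b]. *)
Lemma regularity_at_cone (I J H : R -> Prop) (a b : R) (da db qI qJ : nat) :
    supp_in (fun m => mdeg m = da) a -> supp_in (fun m => mdeg m = db) b -> (0 < da)%N ->
    (forall p, I p <-> J (p * (a * b))) -> (forall p, I p -> J (b * p)) ->
    (forall p, I p -> p@_(mnm0 (n:=n)) = 0) ->
    (forall p, H p <-> exists c q, J q /\ p = c * (a * b) + q) ->
    regularity_at I qI -> regularity_at J qJ ->
  regularity_at H (maxn qJ (qI + (db + da)).-1).
Proof.
move=> ha hb da0 colon bIJ I0 HE [qI1 [F [mF leF attF]]] [qJ1 [G [mG leG attG]]].
have [[grF resF minF] [grG resG minG]] := (mF, mG).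
have [psi [psi_homog psi_aug psi_diff]] := chain_lift_exists grF resF grG resG hb bIJ.
pose phi i := a *: psi i.
have phi_lift : @chain_lift n K (a * b) (db + da) F G phi.
  split=> [i||i].
  - move=> k l; rewrite mxE; apply: (supp_inM _ ha (psi_homog i k l)) => m1 m2 m1E m2E.
    by rewrite mdegD m1E -addnA m2E; lia.
  - by rewrite -scalemxAl psi_aug scalerA.
  by rewrite -scalemxAl -scalemxAr psi_diff.
have hab : supp_in (fun m => mdeg m = db + da)%N (a * b).
  by apply: (supp_inM _ ha hb) => m1 m2 m1E m2E; rewrite mdegD m1E m2E addnC.
have phi0 i : const_mx_part (phi i) = 0.
  apply/matrixP=> k l; rewrite !mxE rmorphM /=.
  suff -> : a@_(mnm0 (n:=n)) = 0 by rewrite mul0r.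
  by apply/eqP; rewrite mcoeff_eq0; apply/negP=> /ha; rewrite mdeg0; lia.
split; first by lia.
exists (mapping_cone (a * b) (db + da) phi); split.
- split; first exact: mapping_cone_graded.
    exact: mapping_cone_resolves colon HE.
  exact: mapping_cone_minimal I0 phi0.
- case=> [|i] k /=; case: (split_ordP k) => l ->; rewrite ?join_shiftl ?join_shiftr.
  + by lia.
  + by have := leG _ l; lia.
  + by have := leF _ l; lia.
  + by have := leG _ l; lia.
case: (leqP (qI + (db + da)).-1 qJ) => [_ | _].
  case: attG => [|[i [k kE]]]; [by left | right].
  case: i k kE => [|i] k kE.
    by exists 0%N, (rshift 1 k); rewrite /= join_shiftr.
  by exists i.+1, (rshift (gr_rank F i) k); rewrite /= join_shiftr.
(* If [qI] is 1, the new generator [a * b] itself attains the value, in degree [db + da]. Otherwise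
   an extremal generator of [F] moves up one homological degree, which accounts for the
   predecessor. *)
right; case: attF => [-> | [i [k kE]]].
  by exists 0%N, (lshift (gr_rank G 0) ord0); rewrite /= join_shiftl; lia.
by exists i.+1, (lshift (gr_rank G i.+1) k); rewrite /= join_shiftl kE; lia.
Qed.

End ConeRegularity.

(** * Monomial ideals *)

Section MonomialIdeals.
Variables (n : nat) (K : fieldType).
Local Notation R := {mpoly K[n]}.

Lemma supp_in_or_multiple (U : pred 'X_{1..n}) (u : 'X_{1..n}) (p : R) :
  supp_in (fun m => U m || (u <= m)%MM) p <->
  exists c q, supp_in U q /\ p = c * 'X_[u] + q.
Proof.
split=> [Up | [c [q [Uq ->]]]]; last first.
  apply: supp_inD; last by apply: supp_in_imp Uq => m ->.
  by rewrite supp_inMX => m _; rewrite lem_addr orbT.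
have : supp_in (fun m => (u <= m)%MM) (p - mpart U p).
  move=> m mp; have := supp_in_mpart_sub (U := U) Up mp; have := supp_in_mpartN mp.
  by case: (U m).
move=> /supp_in_multiple[c cE]; exists c, (mpart U p).
by split; [exact: supp_in_mpart | rewrite -cE subrK].
Qed.

Lemma ideal_of_pairs_eq (r : rel 'I_n) (g g' : 'I_n -> 'I_n -> R) (p : R) :
    (forall x y, r x y -> g x y = g' x y) ->
  ideal_of_pairs r g p -> ideal_of_pairs r g' p.
Proof.
move=> gE [c ->]; exists c; apply: eq_bigr => x _.
by apply: eq_bigr => y xy; rewrite gE.
Qed.

(** Reduces membership to a test on single monomials, the form in which the colon ideals are
    computed. *)
Lemma ideal_of_monomials (r : rel 'I_n) (u : 'I_n -> 'I_n -> 'X_{1..n}) (p : R) :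
  ideal_of_pairs r (fun x y => 'X_[u x y]) p <->
  supp_in (fun m => exists x y, r x y /\ (u x y <= m)%MM) p.
Proof.
split=> [[c ->] | up].
  apply: supp_in_sum => x _; apply: supp_in_sum => y xy; rewrite supp_inMX => m _.
  by exists x, y; split=> //; apply: lem_addr.
rewrite [p]mpolyE big_seq; elim/big_ind: _.
- by exists (fun _ _ => 0); rewrite big1 // => x _; rewrite big1 // => y _; rewrite mul0r.
- move=> _ _ [c1 ->] [c2 ->]; exists (fun x y => c1 x y + c2 x y).
  rewrite -big_split /=; apply: eq_bigr => x _.
  by rewrite -big_split /=; apply: eq_bigr => y _; rewrite mulrDl.
move=> m /up[x [y [xy uxy]]].
exists (fun x' y' => if (x' == x) && (y' == y) then p@_m *: 'X_[m - u x y] else 0).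
rewrite (bigD1 x) //= [X in _ + X]big1 ?addr0 => [|x' /negPf x'x]; last first.
  by rewrite big1 // => y' _; rewrite x'x mul0r.
rewrite (bigD1 y) //= big1 ?addr0 => [|y' /andP[_ /negPf y'y]]; last first.
  by rewrite y'y andbF mul0r.
by rewrite !eqxx -scalerAl -mpolyXD submK.
Qed.

Lemma regularity_at_ext (I J : R -> Prop) q :
  (forall p, I p <-> J p) -> regularity_at I q -> regularity_at J q.
Proof.
move=> IJ [q1 [F [[grF [IF F0 Fi] minF] leF attF]]].
split=> //; exists F; split=> //; split=> //; split=> // p.
by rewrite -IJ.
Qed.

(** The zero sequence resolves the zero ideal, and the value is 1 + reg R = 1. *)
Lemma regularity_at0 (I : R -> Prop) : (forall p, I p <-> p = 0) -> regularity_at I 1.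
Proof.
move=> I0; split=> //.
pose Z := @GradedFreeSeq n K (fun _ => 0%N) (fun _ _ => 0%N) (fun _ => 0) 0.
exists Z; split; [split | by move=> i [] | by left].
- by split=> [[]|i []].
- split=> [p|v|i v]; rewrite /= ?I0.
  + split=> [->|[u ->]]; first by exists 0; rewrite mul0mx mxE.
    by rewrite mulmx0 mxE.
  + by split=> _; [exists 0; rewrite mulmx0; apply: thinmx0 | apply: mulmx0].
  + by split=> _; [exists 0; rewrite mulmx0; apply: thinmx0 | apply: mulmx0].
by move=> i [].
Qed.

End MonomialIdeals.

(** * Ideals of paths with powers of the variables *)

Section PathIdeals.
Variables (n : nat) (K : fieldType) (e : nat -> nat).
Hypothesis e_gt0 : forall v, (0 < e v)%N.
Local Notation R := {mpoly K[n.+1]}.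
Local Notation mnm := 'X_{1..n.+1}.
Implicit Types (m v : nat) (M : mnm).

(* The monomials of the ideal of the path on the vertices [0, ..., m - 1], with
   generators [y_v * y_(v+1)] where [y_v = x_v ^ e v]. *)
Definition path_mnm m : pred mnm := fun M =>
  has (fun v => (e v <= M (inord v))%N && (e v.+1 <= M (inord v.+1))%N) (iota 0 m.-1).

Definition path_ideal m : R -> Prop := supp_in (path_mnm m).

Definition power_mnm v : mnm := (U_(inord v) *+ e v)%MM.

Lemma path_mnmP m M : reflect
  (exists2 v, (v.+1 < m)%N & (e v <= M (inord v))%N && (e v.+1 <= M (inord v.+1))%N)
  (path_mnm m M).
Proof.
apply: (iffP hasP) => [[v]|[v vm Mv]].
  by rewrite mem_iota add0n => /andP[_ vm] Mv; exists v => //; lia.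
by exists v => //; rewrite mem_iota; lia.
Qed.

Lemma path_mnmS m M :
  path_mnm m.+2 M = path_mnm m.+1 M || (e m <= M (inord m))%N && (e m.+1 <= M (inord m.+1))%N.
Proof.
rewrite /path_mnm (_ : m.+2.-1 = m + 1)%N; last by rewrite addn1.
by rewrite iotaD has_cat /= orbF.
Qed.

Lemma eq_path_mnm m M M' : (forall v, (v < m)%N -> M (inord v) = M' (inord v)) ->
  path_mnm m M = path_mnm m M'.
Proof.
move=> MM'; apply: eq_in_has => v; rewrite mem_iota => vm.
by rewrite !MM' //; lia.
Qed.

Lemma path_mnm_addl m M M' : path_mnm m M -> path_mnm m (M' + M)%MM.
Proof.
move=> /path_mnmP[v vm /andP[Mv Mv1]]; apply/path_mnmP; exists v => //.
by rewrite !mnmDE; lia.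
Qed.

Lemma path_mnm0 m : path_mnm m 0%MM = false.
Proof. by apply/path_mnmP=> -[v _]; rewrite mnm0E leqNgt e_gt0. Qed.

Lemma power_mnmE v w : (v <= n)%N -> (w <= n)%N ->
  power_mnm v (inord w) = if v == w then e v else 0%N.
Proof.
move=> vn wn; rewrite mulmnE mnm1E -(inj_eq val_inj) /= !inordK //.
by case: eqP; rewrite ?mul1n.
Qed.

Lemma power_mnm_le v M : (power_mnm v <= M)%MM = (e v <= M (inord v))%N.
Proof.
apply/mnm_lepP/idP => [/(_ (inord v))|vM i].
  by rewrite mulmnE mnm1E eqxx mul1n.
by rewrite mulmnE mnm1E; case: eqP => [<-|_]; rewrite ?mul1n.
Qed.

Lemma power_mnm2_le v w M : (v <= n)%N -> (w <= n)%N -> v != w ->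
  (power_mnm v + power_mnm w <= M)%MM = (e v <= M (inord v))%N && (e w <= M (inord w))%N.
Proof.
move=> vn wn vw; apply/idP/andP => [/mnm_lepP vwM | [vM wM]].
  have := vwM (inord v); have := vwM (inord w); rewrite !mnmDE !power_mnmE //.
  by rewrite !eqxx (negPf vw) eq_sym (negPf vw); lia.
apply/mnm_lepP => i; rewrite mnmDE !mulmnE !mnm1E.
have ivw : ~~ ((inord v == i) && (inord w == i)).
  apply/negP=> /andP[/eqP vi /eqP wi]; case/negP: vw; apply/eqP.
  by rewrite -(@inordK n v) ?ltnS // vi -wi inordK.
by move: ivw; case: eqP => [<-|_]; case: eqP => [<-|_] //= _; rewrite ?mul1n ?mul0n ?addn0.
Qed.

Lemma mdeg_power_mnm v : mdeg (power_mnm v) = e v.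
Proof. by rewrite mdegMn mdeg1 mul1n. Qed.

Lemma supp_power_mnm v : supp_in (fun M => mdeg M = e v) ('X_[power_mnm v] : R).
Proof. by apply/supp_inX; apply: mdeg_power_mnm. Qed.

Lemma mcoeff0_supp_in (U : pred mnm) (p : R) :
  U 0%MM = false -> supp_in U p -> p@_0%MM = 0.
Proof. by move=> U0 Up; apply/eqP; rewrite mcoeff_eq0; apply/negP=> /Up; rewrite U0. Qed.

Lemma regularity_at_path_short m : (m <= 1)%N -> regularity_at (path_ideal m) 1.
Proof.
move=> m1; apply: regularity_at0 => p; split=> [Pp | ->]; last exact: supp_in0.
by apply: (supp_in_disjoint (Q := fun=> True) _ Pp) => // M /path_mnmP[v]; lia.
Qed.

(** A principal ideal is a mapping cone in which both [I] and [J] are zero. *)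
Lemma regularity_at_path2 : (1 <= n)%N -> regularity_at (path_ideal 2) (e 0 + e 1).
Proof.
move=> n1.
have nopath m M : (m <= 1)%N -> path_mnm m M = false.
  by move=> m1; apply/path_mnmP=> -[v]; lia.
have -> : (e 0 + e 1 = maxn 1 (1 + (e 0 + e 1)).-1)%N by have := e_gt0 0; lia.
apply: (regularity_at_cone (I := path_ideal 0) (J := path_ideal 1)
         (a := 'X_[power_mnm 1]) (b := 'X_[power_mnm 0])) => //.
- exact: supp_power_mnm.
- exact: supp_power_mnm.
- move=> p; rewrite /path_ideal -mpolyXD supp_inMX.
  by split=> Pp M /Pp; rewrite !nopath.
- by move=> p Pp; rewrite /path_ideal mulrC supp_inMX => M /Pp; rewrite nopath.
- by move=> p; apply: mcoeff0_supp_in; apply: path_mnm0.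
- move=> p; rewrite /path_ideal -mpolyXD -supp_in_or_multiple.
  by split=> Pp M /Pp; rewrite path_mnmS power_mnm2_le // andbC.
- exact: regularity_at_path_short.
- exact: regularity_at_path_short.
Qed.

(* With [P_m] the ideal of the path on [m] vertices, [P_(m+3)] is
   [P_(m+2) + (y_(m+1) y_(m+2))], and the colon ideal is [P_m + (y_m)]. *)
Lemma regularity_at_pathS m q q' :
    (m.+2 <= n)%N -> regularity_at (path_ideal m) q -> regularity_at (path_ideal m.+2) q' ->
  regularity_at (path_ideal m.+3) (maxn q' (q + e m + e m.+1 + e m.+2 - 2)).
Proof.
move=> mn Pq Pq'; have q1 := proj1 Pq.
pose colon M := path_mnm m M || (power_mnm m <= M)%MM.
have colon0 : colon 0%MM = false.
  by rewrite /colon path_mnm0 power_mnm_le mnm0E leqNgt e_gt0.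
(* The variable of index [m] does not occur in P_m, so y_m is a nonzerodivisor modulo P_m. The colon
   ideal of P_m by y_m is thus P_m itself, and a cone with [I] = [J] = P_m and [b] = 1 applies. *)
have regK : regularity_at (supp_in colon : R -> Prop) (q + e m - 1).
  have -> : (q + e m - 1 = maxn q (q + (0 + e m)).-1)%N by have := e_gt0 m; lia.
  apply: (regularity_at_cone (I := path_ideal m) (J := path_ideal m)
           (a := 'X_[power_mnm m]) (b := 1)) => //.
  - exact: supp_power_mnm.
  - by rewrite -mpolyX0; apply/supp_inX; rewrite mdeg0.
  - move=> p; rewrite /path_ideal mulr1 supp_inMX.
    have pathE M : path_mnm m (power_mnm m + M)%MM = path_mnm m M.
      apply: eq_path_mnm => v vm; rewrite mnmDE power_mnmE; try lia.
      by case: eqP => // mv; lia.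
    by split=> Pp M /Pp; rewrite pathE.
  - by move=> p; rewrite mul1r.
  - by move=> p; apply: mcoeff0_supp_in; apply: path_mnm0.
  - by move=> p; rewrite /path_ideal mulr1 -supp_in_or_multiple.
have -> : (maxn q' (q + e m + e m.+1 + e m.+2 - 2) =
           maxn q' ((q + e m - 1) + (e m.+1 + e m.+2)).-1)%N.
  by have := e_gt0 m; have := e_gt0 m.+1; have := e_gt0 m.+2; lia.
(* The factor y_(m+1) alone already carries P_m + (y_m) into P_(m+2), because y_m y_(m+1) is a
   generator there. This leaves y_(m+2) as the factor [a] that makes the cone minimal. *)
apply: (regularity_at_cone (I := supp_in colon) (J := path_ideal m.+2)
         (a := 'X_[power_mnm m.+2]) (b := 'X_[power_mnm m.+1])) => //.
- exact: supp_power_mnm.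
- exact: supp_power_mnm.
- move=> p; rewrite /path_ideal -mpolyXD supp_inMX.
  suff colonE M : path_mnm m.+2 (power_mnm m.+2 + power_mnm m.+1 + M)%MM = colon M.
    by split=> Pp M /Pp; rewrite colonE.
  set M' := (_ + M)%MM.
  have M'E v : (v <= m)%N -> M' (inord v) = M (inord v).
    move=> vm; rewrite !mnmDE !power_mnmE; try lia.
    by do 2![case: eqP => [?|_]; first by lia].
  have M'm1 : (e m.+1 <= M' (inord m.+1))%N.
    by rewrite !mnmDE !power_mnmE ?eqxx; lia.
  have pathE : path_mnm m M' = path_mnm m M.
    by apply: eq_path_mnm => v vm; rewrite M'E //; lia.
  rewrite path_mnmS M'm1 andbT M'E // /colon power_mnm_le.
  (* The edge from [m] to [m.+1] has become the condition that y_m divides [M], which absorbs the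
     edge ending at [m]. *)
  clearbody M'; clear -pathE M'E; case: m pathE M'E => [//|m'] pathE M'E.
  rewrite path_mnmS pathE (M'E m'.+1) //.
  by case: (e m'.+1 <= _)%N; rewrite ?andbF ?orbF ?orbT.
- move=> p Cp; rewrite /path_ideal mulrC supp_inMX => M /Cp /orP[PM | ].
    apply: path_mnm_addl; have /path_mnmP[v vm Mv] := PM.
    by apply/path_mnmP; exists v => //; lia.
  rewrite power_mnm_le path_mnmS => mM; apply/orP; right.
  by rewrite !mnmDE !power_mnmE ?eqxx; lia.
- by move=> p; apply: mcoeff0_supp_in.
- move=> p; rewrite /path_ideal -mpolyXD -supp_in_or_multiple.
  have powE M : (power_mnm m.+2 + power_mnm m.+1 <= M)%MM =
      (e m.+1 <= M (inord m.+1))%N && (e m.+2 <= M (inord m.+2))%N.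
    by rewrite andbC power_mnm2_le //; lia.
  by split=> Pp M /Pp; rewrite (path_mnmS m.+1) powE.
Qed.

Definition weight_sum k : nat := (\sum_(i < k.+1) e (3 * i))%N.

(* Equal to [1 + weight_sum k - min_(i <= k) e (3 * i)], see [path_reg_min]. *)
Fixpoint path_reg k : nat :=
  if k is l.+1 then maxn (weight_sum l).+1 (path_reg l + e (3 * l.+1)%N) else 1.

Lemma weight_sumS k : weight_sum k.+1 = (weight_sum k + e (3 * k.+1))%N.
Proof. by rewrite /weight_sum big_ord_recr. Qed.

(** The additive form of the closed formula. In the recursion the first term of the maximum
    corresponds to the new weight being the minimum, the second to keeping the old minimum. *)
Lemma path_reg_bounds k :
  (forall i, (i <= k)%N -> ((weight_sum k).+1 <= path_reg k + e (3 * i))%N) /\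
  exists2 i, (i <= k)%N & (path_reg k + e (3 * i) = (weight_sum k).+1)%N.
Proof.
elim: k => [|k [lek [i ik iE]]].
  have -> : weight_sum 0 = e (3 * 0)%N by rewrite /weight_sum big_ord1.
  split=> [i|]; last by exists 0%N.
  by rewrite leqn0 => /eqP ->.
rewrite weight_sumS /=; split=> [j|].
  by rewrite leq_eqVlt ltnS => /orP[/eqP ->|/lek]; lia.
case: (leqP (weight_sum k).+1 (path_reg k + e (3 * k.+1)%N)) => _.
  by exists i; lia.
by exists k.+1 => //; lia.
Qed.

Lemma path_reg_min k j : (j <= k)%N ->
    (forall i, (i <= k)%N -> (e (3 * j) <= e (3 * i))%N) ->
  (path_reg k + e (3 * j))%N = (weight_sum k).+1.
Proof.
move=> jk jmin; have [lek [i ik iE]] := path_reg_bounds k.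
by have := lek j jk; have := jmin i ik; lia.
Qed.

Lemma path_reg_gt1 k : (0 < k)%N -> (1 < path_reg k)%N.
Proof.
case: k => // l _; rewrite /= /weight_sum big_ord_recl /=.
by have := e_gt0 (3 * 0)%N; lia.
Qed.

Lemma regularity_at_path k : (forall v, ~~ (3 %| v)%N -> e v = 1%N) ->
  (3 * k <= n)%N -> regularity_at (path_ideal (3 * k).+1) (path_reg k).
Proof.
move=> e1.
have e31 l : e (3 * l).+1 = 1%N by apply: e1; lia.
have e32 l : e (3 * l).+2 = 1%N by apply: e1; lia.
(* The recursion reaches back three vertices, so the three residues modulo 3 are carried together.
   Only the first involves the minimum; in the other two the full sum of weights survives. *)
suff : [/\ (3 * k <= n)%N -> regularity_at (path_ideal (3 * k).+1) (path_reg k),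
           (3 * k < n)%N -> regularity_at (path_ideal (3 * k).+2) (weight_sum k).+1
         & (3 * k + 1 < n)%N -> regularity_at (path_ideal (3 * k).+3) (weight_sum k).+1].
  by case.
elim: k => [|k [IH1 IH2 IH3]].
  have S0 : weight_sum 0 = e 0 by rewrite /weight_sum big_ord1.
  have reg2 : (1 <= n)%N -> regularity_at (path_ideal 2) (e 0).+1.
    by move/regularity_at_path2; rewrite (e31 0) addn1.
  split=> [_|n1|n2]; first exact: regularity_at_path_short.
    by rewrite S0; apply: reg2.
  have := regularity_at_pathS n2 (regularity_at_path_short (leq0n 1)) (reg2 (ltnW n2)).
  by rewrite (e31 0) (e32 0) S0; congr regularity_at; lia.
have kE : (3 * k.+1 = (3 * k).+3)%N by lia.
have ekE : e (3 * k).+3 = e (3 * k.+1)%N by rewrite kE.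
have reg1 : (3 * k.+1 <= n)%N -> regularity_at (path_ideal (3 * k.+1).+1) (path_reg k.+1).
  move=> kn; have := @regularity_at_pathS (3 * k).+1 _ _ _ (IH1 _) (IH3 _).
  rewrite e31 e32 ekE -kE /=.
  have -> : (path_reg k + 1 + 1 + e (3 * k.+1) - 2 = path_reg k + e (3 * k.+1))%N by lia.
  by apply; lia.
(* This makes the second term of the maximum win for 3k + 5 vertices. *)
have reg_le : (path_reg k.+1 <= (weight_sum k.+1).+1)%N.
  by have [i _] := (path_reg_bounds k.+1).2; lia.
have reg2 : (3 * k.+1 < n)%N -> regularity_at (path_ideal (3 * k.+1).+2) (weight_sum k.+1).+1.
  move=> kn; have := @regularity_at_pathS (3 * k).+2 _ (path_reg k.+1) _ (IH2 _).
  rewrite e32 -kE e31.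
  have -> : (maxn (path_reg k.+1) ((weight_sum k).+1 + 1 + e (3 * k.+1) + 1 - 2) =
             (weight_sum k.+1).+1)%N by have := weight_sumS k; lia.
  by apply; [lia | lia | apply: reg1; lia].
split=> // kn.
have := @regularity_at_pathS (3 * k).+3 _ (weight_sum k.+1).+1 _ (IH3 _).
rewrite -kE e31 e32.
have -> : (maxn (weight_sum k.+1).+1 ((weight_sum k).+1 + e (3 * k.+1) + 1 + 1 - 2) =
           (weight_sum k.+1).+1)%N by have := weight_sumS k; lia.
by apply; [lia | lia | apply: reg2; lia].
Qed.

(** The generators are symmetric in the two ends of an edge, so neither orientation nor listing an
    edge twice changes the ideal. One statement thus serves both [arc D] and [underlying D]. *)
Lemma ideal_of_path_pairs (r : rel 'I_n.+1) (p : R) :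
    (forall x y, r x y || r y x = path_edge x y) ->
  ideal_of_pairs r (fun x y => 'X_[power_mnm x + power_mnm y]) p <-> path_ideal n.+1 p.
Proof.
move=> rE; rewrite ideal_of_monomials.
have edge_neq x y : r x y -> x != y :> nat.
  by move=> xy; have := rE x y; rewrite xy /path_edge /= => /esym/orP[]/eqP; lia.
have le_n (x : 'I_n.+1) : (x <= n)%N by rewrite -ltnS.
suff pathE M : (exists x y, r x y /\ (power_mnm x + power_mnm y <= M)%MM) <-> path_mnm n.+1 M.
  by split=> Pp M /Pp /pathE.
split=> [[x [y [xy]]] | /path_mnmP[v vn Mv]].
  rewrite power_mnm2_le ?edge_neq // => /andP[Mx My]; apply/path_mnmP.
  have := rE x y; rewrite xy => /esym/orP[]/eqP E.
    by exists x; rewrite ?E ?Mx ?My //.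
  by exists y; rewrite ?E ?Mx ?My //.
pose x : 'I_n.+1 := inord v; pose y : 'I_n.+1 := inord v.+1.
have xE : x = v :> nat by rewrite inordK; lia.
have yE : y = v.+1 :> nat by rewrite inordK.
have /orP[xy | yx] : r x y || r y x by rewrite rE /path_edge xE yE eqxx.
  by exists x, y; rewrite power_mnm2_le ?edge_neq // xE yE.
by exists y, x; rewrite power_mnm2_le ?edge_neq // xE yE andbC.
Qed.

End PathIdeals.

(** * The class T_1 and the regularity formula *)

Lemma sum_multiples_of_3 (V : nmodType) (f : nat -> V) k :
  \sum_(v < (3 * k).+1 | (3 %| v)%N) f v = \sum_(i < k.+1) f (3 * i)%N.
Proof.
rewrite -(big_mkord (fun v => 3 %| v)%N f).
elim: k => [|k IHk]; first by rewrite muln0 big_mkcond big_nat1 big_ord1.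
rewrite big_ord_recr /= -IHk (_ : (3 * k.+1).+1 = (3 * k).+1.+3)%N; last by lia.
rewrite big_mkcond [in RHS]big_mkcond !big_nat_recr //=.
have -> : (3 %| (3 * k).+1)%N = false by lia.
have -> : (3 %| (3 * k).+2)%N = false by lia.
rewrite !addr0 (_ : (3 * k).+3 = 3 * k.+1)%N; last by lia.
by rewrite !dvdn_mulr.
Qed.

(** Strong induction on [v], comparing it with the largest multiple of 3 below it, which lies in V^+
    while nothing strictly between does. *)
Lemma class_T1_Vplus n (D : weighted_oriented_graph 'I_n.+1) :
  class_T1 D -> forall v : 'I_n.+1, (v \in Vplus D) = (3 %| v)%N.
Proof.
move=> [_ _ V0 Vn V3] v; have [m] := ubnP (nat_of_ord v).
elim: m v => // m IH v vm.
have [v0 | v_gt0] := posnP v; first by rewrite v0 dvdn0 (_ : v = ord0) //; apply: val_inj.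
have ltv := ltn_ord v.
pose u : 'I_n.+1 := inord (3 * (v.-1 %/ 3)).
have uE : u = (3 * (v.-1 %/ 3))%N :> nat by rewrite inordK; lia.
have uV : u \in Vplus D by rewrite IH ?uE; lia.
have gapV (z : 'I_n.+1) : (u < z < v)%N -> z \notin Vplus D.
  by move=> uzv; rewrite IH; lia.
apply/idP/idP => [vV | v3].
  by have vu : (v - u = 3)%N; [apply: V3 => //; lia | lia].
apply/negPn/negP => vV.
(* The last vertex is in V^+, so there is a next vertex [y] of V^+ after [u]. It is at distance 3,
   hence equal to [v]. *)
have un : (u < (ord_max : 'I_n.+1))%N by rewrite /=; lia.
case: (arg_minnP (P := fun y : 'I_n.+1 => (y \in Vplus D) && (u < y)%N)
         (i0 := ord_max) (fun y => nat_of_ord y)) => [|y /andP[yV uy] ymin].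
  by rewrite Vn un.
have yu : (y - u)%N = 3%N.
  apply: V3 => // z /andP[uz zy]; apply/negP => zV.
  by have := ymin z; rewrite zV uz => /(_ isT); lia.
by case/negP: vV; rewrite (_ : v = y) //; apply: val_inj => /=; lia.
Qed.

Theorem theorem4p3 (K : fieldType) (n : nat)
    (D : weighted_oriented_graph 'I_n.+1) (hD : class_T1 D)
    (j : 'I_n.+1) (hj : j \in Vplus D)
    (hmin : forall i, i \in Vplus D -> (weight D j <= weight D i)%N) :
  reg (weighted_edge_ideal K D) =
  reg (edge_ideal K (underlying D)) +
  \sum_(i in Vplus D :\ j) ((weight D i)%:Z - 1).
Proof.
have VE := class_T1_Vplus hD; have [pathD sinkD _ Vn _] := hD.
have arcE x y : Defs.arc D x y || Defs.arc D y x = path_edge x y := pathD x y.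
have weight1 x : x \notin Vplus D -> weight D x = 1%N.
  by rewrite inE; have := weight_gt0 D x; lia.
(* The tail of an arc is not a sink, so it has weight 1. The generator of the arc is therefore the
   product of the weighted powers of both ends. *)
have tail1 x y : Defs.arc D x y -> weight D x = 1%N.
  move=> xy; apply: weight1; apply/negP => /sinkD /(_ y).
  by rewrite /underlying xy => /(_ isT); apply/negP/arc_asym.
have /dvdnP[k nE] : (3 %| n)%N by have := Vn; rewrite VE.
rewrite mulnC in nE; subst n.
(* Beyond the path the value 1 keeps [e] positive, and equal to 1 off the multiples of 3. *)
pose e v := if (v <= 3 * k)%N then weight D (inord v) else 1%N.
have eE (x : 'I_(3 * k).+1) : e x = weight D x by rewrite /e -ltnS ltn_ord inord_val.
have e_gt0 v : (0 < e v)%N by rewrite /e; case: ifP => // _; apply: weight_gt0.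
(* On a path of length 0 the only vertex is a source, so it has weight 1 and cannot lie in V^+. *)
have k_gt0 : (0 < k)%N.
  rewrite lt0n; apply/eqP => k0; have := Vn; rewrite inE.
  rewrite (source_weight (w := D)) // => y; apply/negP => arc_y.
  have := arcE y ord_max; rewrite arc_y /path_edge /= => /esym.
  by have := ltn_ord y; lia.
have weightI : regularity_at (weighted_edge_ideal K D) (path_reg e k).
  have e1 v : ~~ (3 %| v)%N -> e v = 1%N.
    by rewrite /e; case: leqP => // vn v3; apply: weight1; rewrite VE inordK.
  have := @regularity_at_path (3 * k) K e e_gt0 k e1 (leqnn _).
  apply: regularity_at_ext => p; rewrite -(@ideal_of_path_pairs _ _ e (Defs.arc D)) //.
  have genE x y : Defs.arc D x y ->
      'X_[power_mnm (3 * k) e x + power_mnm (3 * k) e y] =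
      'X_x * 'X_y ^+ weight D y :> {mpoly K[(3 * k).+1]}.
    move=> xy; rewrite mpolyXD /power_mnm !inord_val !eE.
    by rewrite (tail1 _ _ xy) mulm1n mpolyXn.
  by split; apply: ideal_of_pairs_eq => x y /genE.
have edgeI : regularity_at (edge_ideal K (underlying D)) (path_reg (fun=> 1%N) k).
  have := @regularity_at_path (3 * k) K (fun=> 1%N) (fun=> isT) k (fun _ _ => erefl) (leqnn _).
  apply: regularity_at_ext => p.
  rewrite -(@ideal_of_path_pairs _ _ (fun=> 1%N) (underlying D)) // => [|x y]; last first.
    by rewrite !pathD /path_edge orbC; case: eqP; case: eqP.
  by split; apply: ideal_of_pairs_eq => x y _; rewrite mpolyXD /power_mnm !inord_val.
rewrite (reg_eq weightI) ?(reg_eq edgeI) ?path_reg_gt1 //.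
(* With unit exponents the minimum is 1 and the sum is k + 1, so reg I(G) = k + 1. *)
have edge_reg : (path_reg (fun=> 1) k + 1 = (weight_sum (fun=> 1) k).+1)%N.
  exact: (@path_reg_min (fun=> 1%N) k 0).
have edge_sum : weight_sum (fun=> 1%N) k = k.+1.
  by rewrite /weight_sum sum_nat_const card_ord muln1.
have [j0 jE] : exists j0, j = (3 * j0)%N :> nat.
  by exists (j %/ 3)%N; have := hj; rewrite VE; lia.
have jk : (3 * j0 <= 3 * k)%N by rewrite -jE -ltnS.
have e_inord i : (i <= k)%N -> e (3 * i)%N = weight D (inord (3 * i)).
  by move=> ik; rewrite /e ifT //; lia.
have e_j : e (3 * j0)%N = weight D j by rewrite -jE eE.
have weight_reg : (path_reg e k + e (3 * j0) = (weight_sum e k).+1)%N.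
  apply: path_reg_min => [|i ik]; first by lia.
  by rewrite e_j e_inord // hmin // VE inordK ?dvdn_mulr //; lia.
have sumV : \sum_(i in Vplus D) ((weight D i)%:Z - 1) = (weight_sum e k)%:Z - k.+1%:Z.
  under eq_bigl => i do rewrite VE.
  under eq_bigr => i _ do rewrite -eE.
  rewrite (sum_multiples_of_3 (fun v => (e v)%:Z - 1)) sumrB sumr_const card_ord.
  by rewrite /weight_sum (big_morph Posz PoszD (erefl _)) natz.
move: sumV; rewrite (big_setD1 j) //=; set S := \sum_(i in _ :\ j) _ => sumV.
by rewrite e_j in weight_reg; rewrite edge_sum in edge_reg; lia.
Qed.
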